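(* Let $\sigma>0$ and consider $\phi(x)=x^2$, $B=\sigma^2$. For every $\Delta>0$, $$r_M'(\Delta)=r_M(\Delta)=r(\Delta)=\tfrac12\log\Bigl(1+\bigl(\tfrac{\Delta}{\sigma}\bigr)^2\Bigr).$$ Moreover: (Dual certificate) The multipliers $\lambda_1^\star=\dfrac{\Delta}{\sigma^2+\Delta^2}$, $\lambda_2^\star=\dfrac{\Delta^2}{2\sigma^2(\sigma^2+\Delta^2)}$ certify this rate: $\lambda^\star=(\lambda^\star_1,\lambda_2^\star)\in C$ and there is a non-decreasing $\psi:\mathbb R\to\mathbb R$ with $\psi_l^{\lambda^\star}(x)+r(\Delta)\le\psi(x)\le\psi_u^{\lambda^\star}(x)-r(\Delta)$ for all $x\in\mathbb R$. (Primal certificate) The supremum defining $r(\Delta)$ is attained by the pair $$P^\star_{\pm\Delta}=\frac{1\mp s^\star}{2}\,\delta_{-a}+\frac{1\pm s^\star}{2}\,\delta_{a},\qquad s^\star=\frac{\Delta/\sigma}{\sqrt{1+(\Delta/\sigma)^2}}\in(0,1),\quad a=\sigma\sqrt{1+(\Delta/\sigma)^2}=\Delta/s^\star,$$ i.e. $P^\star_{\pm\Delta}\in\mathcal C_{\pm\Delta}$ and $\rho(P^\star_{-\Delta},P^\star_{\Delta})=e^{-r(\Delta)}$.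
   Context: For $\mu\in\mathbb R$, $\mathcal C_\mu$ is the set of Borel probability measures $P$ on $\mathbb R$ with $\int x\,dP=\mu$ and $\int\phi(x-\mu)\,dP\le B$; here $\phi(x)=x^2$, $B=\sigma^2$. $r(\Delta):=-\log\sup\{\rho(P_-,P_+): P_-\in\mathcal C_{-\Delta},\,P_+\in\mathcal C_{\Delta}\}$, where $\rho(P_-,P_+)=\int\sqrt{dP_-\,dP_+}$ is the Hellinger affinity (computed with densities with respect to any common dominating measure). $r_M(\Delta)$ is the supremum of all $r\in\mathbb R$ for which there exists a non-decreasing $\psi:\mathbb R\to\mathbb R$ with $\sup_{P\in\mathcal C_0}\log E_P[e^{\psi(X-\Delta)}]+r\le0$ and $\sup_{P\in\mathcal C_0}\log E_P[e^{-\psi(X+\Delta)}]+r\le0$. For $\lambda=(\lambda_1,\lambda_2)\in\mathbb R\times[0,\infty)$ put $g_u^\lambda(x)=1+\lambda_1x+\lambda_2(\phi(x)-B)$, $g_l^\lambda(x)=1-\lambda_1x+\lambda_2(\phi(x)-B)$. $C$ is the set of $\lambda\in\mathbb R\times[0,\infty)$ with $g_u^\lambda>0$ and $g_l^\lambda>0$ on $\mathbb R$. For $\lambda\in C$, $\psi_u^\lambda(x)=\log g_u^\lambda(x+\Delta)$ and $\psi_l^\lambda(x)=-\log g_l^\lambda(x-\Delta)$. $r_M'(\Delta)$ is the supremum of all $r\in\mathbb R$ for which there exist $\lambda\in C$ and a non-decreasing $\psi:\mathbb R\to\mathbb R$ with $\psi_l^\lambda(x)+r\le\psi(x)\le\psi_u^\lambda(x)-r$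 for all $x\in\mathbb R$. *)

(* Defs.v *)
From HB Require Import structures.
From mathcomp Require Import all_boot all_order all_algebra.
From mathcomp Require Import all_classical all_reals all_analysis.
From mathcomp Require Import measurable_realfun.

Set Implicit Arguments.
Unset Strict Implicit.
Unset Printing Implicit Defensive.

Import Order.TTheory GRing.Theory Num.Theory.
Import numFieldNormedType.Exports.

Local Open Scope classical_set_scope.
Local Open Scope ring_scope.

Section hellinger.
Context d (T : measurableType d) (R : realType).

Section finite_measure_add.
Variables P Q : {finite_measure set T -> \bar R}.

HB.instance Definition _ := Measure.on (measure_add P Q).

Let measure_add_fin : fin_num_fun (measure_add P Q).
Proof. by move=> A mA; rewrite measure_addE fin_numD !fin_num_measure. Qed.

HB.instance Definition _ :=
  Measure_isFinite.Build _ _ _ (measure_add P Q) measure_add_fin.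

End finite_measure_add.

Local Open Scope charge_scope.

Definition hellinger_wrt (nu : {sigma_finite_measure set T -> \bar R})
    (P Q : probability T R) : \bar R :=
  (\int[nu]_x (Num.sqrt (fine ('d (charge_of_finite_measure P) '/d nu x) *
                         fine ('d (charge_of_finite_measure Q) '/d nu x)))%:E)%E.

(* Any sigma-finite measure dominating both P and Q gives the same value, see
   [hellinger_wrtE]; P + Q is one that always exists. *)
Definition hellinger (P Q : probability T R) : \bar R :=
  hellinger_wrt (measure_add P Q) P Q.

Let dominates_addl (P Q : {finite_measure set T -> \bar R}) :
  P `<< measure_add P Q.
Proof.
apply/null_content_dominatesP => A mA.
have := measure_addE P Q A; rewrite /= => -> /eqP.
by rewrite padde_eq0// => /andP[/eqP].
Qed.

Let dominates_addr (P Q : {finite_measure set T -> \bar R}) :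
  Q `<< measure_add P Q.
Proof.
apply/null_content_dominatesP => A mA.
have := measure_addE P Q A; rewrite /= => -> /eqP.
by rewrite padde_eq0// => /andP[_ /eqP].
Qed.

Let measurable_hellinger (nu : {sigma_finite_measure set T -> \bar R})
    (P Q : probability T R) : P `<< nu -> Q `<< nu ->
  measurable_fun setT (fun x =>
    (Num.sqrt (fine ('d (charge_of_finite_measure P) '/d nu x) *
               fine ('d (charge_of_finite_measure Q) '/d nu x)))%:E).
Proof.
move=> Pnu Qnu; apply/measurable_EFinP.
apply: (@measurableT_comp _ _ _ _ _ _ (@Num.sqrt R)).
  exact: (continuous_measurable_fun (@sqrt_continuous R)).
by apply: measurable_funM; apply: measurableT_comp => //;
  apply: measurable_int; apply: Radon_Nikodym_integrable.
Qed.

Lemma hellinger_wrtE (nu : {sigma_finite_measure set T -> \bar R})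
    (P Q : probability T R) :
  P `<< nu -> Q `<< nu -> hellinger_wrt nu P Q = hellinger P Q.
Proof.
move=> Pnu Qnu; pose la := measure_add P Q : {finite_measure set T -> \bar R}.
have Pla : P `<< la by exact: dominates_addl.
have Qla : Q `<< la by exact: dominates_addr.
have lanu : la `<< nu.
  apply/null_content_dominatesP => A mA nuA; rewrite [LHS]measure_addE.
  move: Pnu Qnu => /null_content_dominatesP Pnu /null_content_dominatesP Qnu.
  by have /= -> := Pnu A mA nuA; have /= -> := Qnu A mA nuA; rewrite adde0.
rewrite /hellinger /hellinger_wrt.
pose g := Radon_Nikodym_SigmaFinite.f la nu.
rewrite -(@Radon_Nikodym_SigmaFinite.change_of_variables _ _ _ la nu)//;
  last exact: measurable_hellinger.
apply: ge0_ae_eq_integral => //.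
- exact: measurable_hellinger.
- apply: emeasurable_funM; first exact: measurable_hellinger.
  exact: measurable_int (Radon_Nikodym_SigmaFinite.f_integrable lanu).
- by move=> x _; rewrite mule_ge0// Radon_Nikodym_SigmaFinite.f_ge0.
have cP := @Radon_Nikodym_chain_rule _ _ _ (charge_of_finite_measure P) nu la
  Pla lanu.
have cQ := @Radon_Nikodym_chain_rule _ _ _ (charge_of_finite_measure Q) nu la
  Qla lanu.
have cg := @ae_eq_Radon_Nikodym_SigmaFinite _ _ _ la nu lanu setT measurableT.
apply: filterS3 cP cQ cg => x /(_ I) /= -> /(_ I) /= -> /(_ I) <- _.
rewrite -/g.
have gfin : g x \is a fin_num by exact: Radon_Nikodym_SigmaFinite.f_fin_num.
have g0 : (0 <= g x)%E by exact: Radon_Nikodym_SigmaFinite.f_ge0.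
rewrite !fineM ?Radon_Nikodym_fin_num// mulrACA -expr2.
rewrite mulrC sqrtrM ?sqr_ge0// sqrtr_sqr ger0_norm ?fine_ge0//.
by rewrite EFinM fineK// muleC.
Qed.

End hellinger.

Section separation_rates.
Context (R : realType).
Variables (phi : R -> R) (B : R).
Implicit Types (mu Delta r : R) (lam : R * R) (psi : R -> R).

Definition moment_class mu : set (probability R R) :=
  [set P : probability R R |
    [/\ P.-integrable setT (fun x : R => x%:E),
        (\int[P]_x x%:E = mu%:E)%E &
        (\int[P]_x (phi (x - mu))%:E <= B%:E)%E]].

(* The suprema below live in \bar R, so that no boundedness or non-emptiness
   is presupposed; [lne] maps 0 to -oo and +oo to +oo. *)
Definition hellinger_rate Delta : \bar R :=
  (- lne (ereal_sup [set hellinger P Q | P in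
            moment_class (- Delta) & Q in moment_class Delta]))%E.

Definition exp_rate Delta : \bar R :=
  ereal_sup [set r%:E | r in [set r | exists psi,
    [/\ nondecreasing_fun psi,
        (ereal_sup [set lne 'E_P[(fun x : R => expR (psi (x - Delta)))%R]
                   | P in moment_class 0] + r%:E <= 0)%E &
        (ereal_sup [set lne 'E_P[(fun x : R => expR (- psi (x + Delta)))%R]
                   | P in moment_class 0] + r%:E <= 0)%E]]].

Definition g_u lam (x : R) : R := 1 + lam.1 * x + lam.2 * (phi x - B).
Definition g_l lam (x : R) : R := 1 - lam.1 * x + lam.2 * (phi x - B).

Definition multipliers : set (R * R) :=
  [set lam | 0 <= lam.2 /\ forall x, 0 < g_u lam x /\ 0 < g_l lam x].

Definition psi_u Delta lam (x : R) : R := ln (g_u lam (x + Delta)).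
Definition psi_l Delta lam (x : R) : R := - ln (g_l lam (x - Delta)).

Definition multiplier_rate Delta : \bar R :=
  ereal_sup [set r%:E | r in [set r | exists lam psi,
    [/\ multipliers lam, nondecreasing_fun psi &
        forall x, psi_l Delta lam x + r <= psi x <= psi_u Delta lam x - r]]].

End separation_rates.

(* Main.v *)
(* The chain r_M' <= r_M <= r holds for every measurable phi >= 0.  Integrating
   exp psi <= e^(-r) g_u^lambda against a centred law of the class bounds the
   exponential moment by e^(-r), and by AM-GM, sqrt (p q) is at most the mean of
   p e^psi and q e^(-psi), so the affinity is at most e^(-r) for any feasible
   (psi, r).  For phi = x^2 the two-point pair gives r <= r0 :=
   ln (1 + (Delta / sigma)^2) / 2.  Conversely, with D = sigma^2 + Delta^2,
   c = D / Delta and lambda the stated multipliers,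
   g_u (x + Delta) = G x and g_l (x - Delta) = G (- x) for
   G x = 1/2 + lambda_2 (x + c)^2, and
   G x * G (- x) = e^(2 r0) + (lambda_2 (x^2 - D))^2,
   so psi_l + r0 <= psi_u - r0; the lower bound psi_l + r0 increases up to c and
   the upper bound psi_u - r0 increases from - c on, so freezing the lower bound
   after c yields a monotone psi in between. *)
From HB Require Import structures.
Require Import Defs.
From mathcomp Require Import all_boot all_order all_algebra.
From mathcomp Require Import all_classical all_reals all_analysis.
From mathcomp Require Import measurable_realfun.
From mathcomp Require Import ring lra.

Import Order.TTheory GRing.Theory Num.Theory.
Import numFieldNormedType.Exports.

Local Open Scope classical_set_scope.
Local Open Scope ring_scope.

(** AM-GM for t p and q / t, whose product is p q. It is applied pointwise to two densities with t =
    e^psi. *)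
Lemma sqrtrM_le_weighted_mean (R : rcfType) (p q t : R) :
  0 <= p -> 0 <= q -> 0 < t -> Num.sqrt (p * q) <= 2^-1 * (t * p + t^-1 * q).
Proof.
move=> p0 q0 t0.
rewrite -[leRHS]ger0_norm; last first.
  by rewrite mulr_ge0// addr_ge0// mulr_ge0// ?invr_ge0 ltW.
rewrite -sqrtr_sqr ler_sqrt ?sqr_ge0//.
have -> : (2^-1 * (t * p + t^-1 * q)) ^+ 2 =
    p * q + (2^-1 * (t * p - t^-1 * q)) ^+ 2.
  by field; rewrite gt_eqF.
by rewrite lerDl sqr_ge0.
Qed.

Lemma null_dominates_measure_addl d (T : measurableType d) (R : realType)
    (P Q : {finite_measure set T -> \bar R}) : P `<< measure_add P Q.
Proof.
apply/null_content_dominatesP => A mA.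
have := measure_addE P Q A; rewrite /= => -> /eqP.
by rewrite padde_eq0// => /andP[/eqP].
Qed.

Lemma null_dominates_measure_addr d (T : measurableType d) (R : realType)
    (P Q : {finite_measure set T -> \bar R}) : Q `<< measure_add P Q.
Proof.
apply/null_content_dominatesP => A mA.
have := measure_addE P Q A; rewrite /= => -> /eqP.
by rewrite padde_eq0// => /andP[_ /eqP].
Qed.

(** * Weak duality for the Hellinger affinity *)

Section weak_duality.
Context d (T : measurableType d) (R : realType).
Local Open Scope charge_scope.

Lemma measurable_sqrt_fineM (f g : T -> \bar R) :
  measurable_fun setT f -> measurable_fun setT g ->
  measurable_fun setT (fun x => (Num.sqrt (fine (f x) * fine (g x)))%:E).
Proof.
move=> mf mg; apply/measurable_EFinP.
apply: (@measurableT_comp _ _ _ _ _ _ (@Num.sqrt R)).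
  exact: (continuous_measurable_fun (@sqrt_continuous R)).
by apply: measurable_funM; apply: measurableT_comp.
Qed.

(* These densities, unlike 'd P '/d nu, are nonnegative everywhere and not just
   almost everywhere. *)
Lemma hellinger_change_of_variables
    (nu : {sigma_finite_measure set T -> \bar R}) (P Q : probability T R) :
  P `<< nu -> Q `<< nu ->
  hellinger P Q = (\int[nu]_x
    (Num.sqrt (fine (Radon_Nikodym_SigmaFinite.f P nu x) *
               fine (Radon_Nikodym_SigmaFinite.f Q nu x)))%:E)%E.
Proof.
move=> Pnu Qnu.
have cP := @ae_eq_Radon_Nikodym_SigmaFinite _ _ _ P nu Pnu setT measurableT.
have cQ := @ae_eq_Radon_Nikodym_SigmaFinite _ _ _ Q nu Qnu setT measurableT.
rewrite -(hellinger_wrtE Pnu Qnu); apply: ge0_ae_eq_integral => //.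
- by apply: measurable_sqrt_fineM; apply: measurable_int;
    apply: Radon_Nikodym_integrable.
- by apply: measurable_sqrt_fineM; apply: measurable_int;
    exact: Radon_Nikodym_SigmaFinite.f_integrable.
- by apply: filterS2 cP cQ => x /(_ I) -> /(_ I) ->.
Qed.

(** With p, q the densities of P, Q with respect to P + Q, weighted AM-GM bounds sqrt (p q)
    pointwise; changing variables turns the integrals of e^psi p and e^(-psi) q into the two assumed
    moments. *)
Lemma hellinger_le (P Q : probability T R) (psi : T -> R) (c : R) :
  measurable_fun setT psi ->
  (\int[P]_x (expR (psi x))%:E <= c%:E)%E ->
  (\int[Q]_x (expR (- psi x))%:E <= c%:E)%E ->
  (hellinger P Q <= c%:E)%E.
Proof.
move=> mpsi Pc Qc.
pose nu := measure_add P Q : {finite_measure set T -> \bar R}.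
have Pnu : P `<< nu by exact: null_dominates_measure_addl.
have Qnu : Q `<< nu by exact: null_dominates_measure_addr.
have me (f : T -> R) : measurable_fun setT f ->
    measurable_fun setT (fun x => (expR (f x))%:E).
  by move=> mf; apply/measurable_EFinP; exact: measurableT_comp.
have mep := me _ mpsi.
have men : measurable_fun setT (fun x => (expR (- psi x))%:E).
  by apply: me; exact: measurableT_comp.
rewrite (hellinger_change_of_variables _ _ _ Pnu Qnu).
set p := Radon_Nikodym_SigmaFinite.f P nu.
set q := Radon_Nikodym_SigmaFinite.f Q nu.
have mp : measurable_fun setT p.
  exact: measurable_int (Radon_Nikodym_SigmaFinite.f_integrable Pnu).
have mq : measurable_fun setT q.
  exact: measurable_int (Radon_Nikodym_SigmaFinite.f_integrable Qnu).
have p0 x : (0 <= p x)%E by exact: Radon_Nikodym_SigmaFinite.f_ge0.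
have q0 x : (0 <= q x)%E by exact: Radon_Nikodym_SigmaFinite.f_ge0.
have pf x : p x \is a fin_num by exact: Radon_Nikodym_SigmaFinite.f_fin_num.
have qf x : q x \is a fin_num by exact: Radon_Nikodym_SigmaFinite.f_fin_num.
have ep0 x : (0 <= (expR (psi x))%:E :> \bar R)%E by rewrite lee_fin expR_ge0.
have en0 x : (0 <= (expR (- psi x))%:E :> \bar R)%E by rewrite lee_fin expR_ge0.
have h2 : (0 <= (2^-1 : R)%:E)%E by rewrite lee_fin invr_ge0.
apply: (@le_trans _ _ (\int[nu]_x ((2^-1)%:E *
    ((expR (psi x))%:E * p x + (expR (- psi x))%:E * q x)))%E).
  apply: ge0_le_integral => //.
  - exact: measurable_sqrt_fineM.
  - apply: emeasurable_funM => //; apply: emeasurable_funD;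
      exact: emeasurable_funM.
  - move=> x _; rewrite -[in leRHS](fineK (pf x)) -[in leRHS](fineK (qf x)).
    rewrite -!EFinM lee_fin expRN.
    by apply: sqrtrM_le_weighted_mean; rewrite ?fine_ge0// expR_gt0.
rewrite ge0_integralZl//; last 2 first.
  - apply: emeasurable_funD; exact: emeasurable_funM.
  - by move=> x _; rewrite adde_ge0// mule_ge0.
rewrite ge0_integralD//; last 4 first.
  - by move=> x _; rewrite mule_ge0.
  - exact: emeasurable_funM.
  - by move=> x _; rewrite mule_ge0.
  - exact: emeasurable_funM.
rewrite !Radon_Nikodym_SigmaFinite.change_of_variables//.
apply: (@le_trans _ _ ((2^-1)%:E * (c%:E + c%:E))%E).
  by rewrite lee_wpmul2l// leeD.
by rewrite -EFinD -EFinM lee_fin; lra.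
Qed.

End weak_duality.

(** Removes logarithms from the rate constraints with no sign or finiteness condition: for x < 0
    both sides hold, since [lne x] is -oo and [expR r] is nonnegative. *)
Lemma lne_leE (R : realType) (x : \bar R) (r : R) :
  (lne x <= r%:E)%E = (x <= (expR r)%:E)%E.
Proof.
have [x0|x0] := leP 0%E x; first by rewrite -lee_expeR lneK// in_itv/= x0 leey.
rewrite le0_lneNy; last exact: ltW.
by rewrite leNye (le_trans (ltW x0))// lee_fin expR_ge0.
Qed.

(** * The chain r_M' <= r_M <= r for measurable phi >= 0 *)

Section rates.
Context (R : realType) (phi : R -> R) (B : R).
Hypotheses (mphi : measurable_fun setT phi) (phi0 : forall x, 0 <= phi x).

(** Q is the law of X - mu under P. This links the classes at - Delta and Delta, used by the
    affinity, to the centred class used by [exp_rate]. *)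
Lemma moment_class_centered mu (P : probability R R) (f : R -> \bar R) :
  moment_class phi B mu P ->
  measurable_fun setT f -> (forall x, 0 <= f x)%E ->
  exists2 Q : probability R R, moment_class phi B 0 Q &
    (\int[Q]_x f x = \int[P]_x f (x - mu)%R)%E.
Proof.
move=> [iP mP vP] mf f0.
have mX : measurable_fun setT (fun x : R => x - mu).
  exact: measurable_funB.
pose X := mfun_Sub (mem_set mX) : {mfun R >-> R}.
have iX : P.-integrable setT (fun x : R => (x - mu)%:E).
  have := integrableB measurableT iP
    (finite_measure_integrable_cst P mu measurableT).
  by apply: eq_integrable => // x _.
exists (distribution P X); last by rewrite ge0_integral_distribution.
split.
- by apply: integrable_pushforward => //; exact/measurable_EFinP.
- rewrite integral_distribution//=.
  under eq_integral do rewrite EFinB.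
  rewrite integralB//; last exact: (finite_measure_integrable_cst P mu).
  by rewrite mP integral_cst//= probability_setT mule1 subee.
- rewrite ge0_integral_distribution//=.
  + by under eq_integral do rewrite /= subr0.
  + apply/measurable_EFinP; apply: measurableT_comp => //.
    exact: measurable_funB.
  + by move=> x; rewrite lee_fin.
Qed.

Lemma exp_rate_le_hellinger_rate Delta :
  (exp_rate phi B Delta <= hellinger_rate phi B Delta)%E.
Proof.
apply: ge_ereal_sup => _ [r [psi [ndpsi hu hl]] <-].
have mpsi : measurable_fun setT psi by exact: nondecreasing_measurable.
(* Used with f = psi (. - Delta), mu = - Delta and with f = - psi (. + Delta), mu = Delta: centring
   cancels the shift, leaving the moments of e^psi and e^(-psi) that [hellinger_le] needs. *)
have bnd (f : R -> R) : measurable_fun setT f ->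
    (ereal_sup [set lne 'E_P[(fun x : R => expR (f x))%R]
       | P in moment_class phi B 0] + r%:E <= 0)%E ->
    forall mu P, moment_class phi B mu P ->
      (\int[P]_x (expR (f (x - mu)))%:E <= (expR (- r))%:E)%E.
  move=> mf hS mu P PC.
  have [|x|Q QC <-] := moment_class_centered _ _ (fun x => (expR (f x))%:E) PC.
  - by apply/measurable_EFinP; exact: measurableT_comp.
  - by rewrite lee_fin expR_ge0.
  rewrite -lne_leE.
  move: hS; rewrite -leeBrDr// sub0e => hS.
  apply: le_trans hS; apply: ereal_sup_ubound; exists Q => //.
  by rewrite unlock.
have mpsiD : measurable_fun setT (fun x : R => psi (x - Delta)).
  by apply: measurableT_comp => //; exact: measurable_funB.
have mpsiN : measurable_fun setT (fun x : R => - psi (x + Delta)).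
  apply: measurableT_comp => //; apply: measurableT_comp => //.
  exact: measurable_funD.
rewrite /hellinger_rate leeNr -EFinN lne_leE.
apply: ge_ereal_sup => _ [P PC [Q QC <-]].
apply: (@hellinger_le _ _ _ P Q psi) => //.
- have := bnd _ mpsiD hu _ _ PC.
  by under eq_integral do rewrite opprK addrK.
- have := bnd _ mpsiN hl _ _ QC.
  by under eq_integral do rewrite subrK.
Qed.

(** The linear term has mean zero, and l2 >= 0 makes the contribution of phi - B nonpositive. The
    moment bound and phi >= 0 give integrability of phi, so the integral may be split. *)
Lemma integral_multiplier_le1 (P : probability R R) (l1 l2 : R) :
  moment_class phi B 0 P -> 0 <= l2 ->
  (\int[P]_x (1 + l1 * x + l2 * (phi x - B))%:E <= 1)%E.
Proof.
move=> [iP mP]; under eq_integral do rewrite subr0; move=> vP l20.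
have iphi : P.-integrable setT (fun x => (phi x)%:E).
  apply/integrableP; split; first exact/measurable_EFinP.
  under eq_integral do rewrite gee0_abs ?lee_fin//.
  exact: le_lt_trans vP (ltry _).
have i1 := integrableZl measurableT l1 iP.
have i2 := integrableZl measurableT l2 iphi.
have ic := finite_measure_integrable_cst P (1 - l2 * B) measurableT.
have -> : (\int[P]_x (1 + l1 * x + l2 * (phi x - B))%:E =
    \int[P]_x ((1 - l2 * B)%:E + l1%:E * x%:E + l2%:E * (phi x)%:E))%E.
  apply: eq_integral => x _; rewrite -!EFinM -!EFinD; congr EFin; ring.
rewrite integralD//; last exact: integrableD.
rewrite integralD// !integralZl// mP mule0 adde0.
rewrite integral_cst//= probability_setT mule1.
apply: (@le_trans _ _ ((1 - l2 * B)%:E + l2%:E * B%:E)%E).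
  by rewrite leeD2l// lee_wpmul2l.
by rewrite -EFinM -EFinD subrK.
Qed.

(** Exponentiating the bound on f gives e^f <= e^(-r) g with g of integral at most 1. The sign of l1
    is free, so the lemma covers [g_u] and, with - lambda_1, also [g_l]. *)
Lemma expectation_expR_le (P : probability R R) (l1 l2 r : R) (f : R -> R) :
  moment_class phi B 0 P -> 0 <= l2 -> measurable_fun setT f ->
  (forall x, 0 < 1 + l1 * x + l2 * (phi x - B)) ->
  (forall x, f x <= ln (1 + l1 * x + l2 * (phi x - B)) - r) ->
  (lne 'E_P[(fun x => expR (f x))%R] <= (- r)%:E)%E.
Proof.
move=> PC l20 mf g0 fg; rewrite unlock lne_leE.
have mg : measurable_fun setT (fun x => 1 + l1 * x + l2 * (phi x - B)).
  apply: measurable_funD.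
    by apply: measurable_funD => //; exact: measurable_funM.
  by apply: measurable_funM => //; exact: measurable_funB.
apply: (@le_trans _ _ (\int[P]_x ((expR (- r))%:E *
    (1 + l1 * x + l2 * (phi x - B))%:E))%E).
  apply: ge0_le_integral => //.
  - by apply/measurable_EFinP; exact: measurableT_comp.
  - by apply/measurable_EFinP; exact: measurable_funM.
  - move=> x _; rewrite -EFinM lee_fin -[X in _ <= _ * X](lnK (g0 x)).
    rewrite -expRD ler_expR addrC; exact: fg.
rewrite ge0_integralZl//.
- rewrite -[leRHS]mule1 lee_wpmul2l ?lee_fin ?expR_ge0//.
  exact: integral_multiplier_le1.
- exact/measurable_EFinP.
- by move=> x _; rewrite lee_fin ltW.
Qed.

Lemma multiplier_rate_le_exp_rate Delta :
  (multiplier_rate phi B Delta <= exp_rate phi B Delta)%E.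
Proof.
apply: le_ereal_sup => _ [r [lam [psi [[l20 gpos] ndpsi hpsi]] <-]].
exists r => //; exists psi.
have mpsi : measurable_fun setT psi by exact: nondecreasing_measurable.
split => //; rewrite -leeBrDr// sub0e; apply: ge_ereal_sup => _ [P PC <-].
- apply: (@expectation_expR_le P lam.1 lam.2) => //.
  + by apply: measurableT_comp => //; exact: measurable_funB.
  + by move=> x; have [] := gpos x.
  + move=> x; have /andP[_] := hpsi (x - Delta).
    by rewrite /psi_u subrK.
- apply: (@expectation_expR_le P (- lam.1) lam.2) => //.
  + apply: measurableT_comp => //; apply: measurableT_comp => //.
    exact: measurable_funD.
  + by move=> x; have [_] := gpos x; rewrite /g_l mulNr.
  + move=> x; have /andP[+ _] := hpsi (x + Delta).
    by rewrite /psi_l addrK /g_l mulNr; lra.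
Qed.

End rates.

(** * Two-point laws on - a and a *)

Section two_point.
Context {R : realType} (a : R).
Implicit Types (p q : R) (f : R -> R).

Definition signed_point (b : bool) : R := if b then a else - a.

Lemma measurable_signed_point : measurable_fun setT signed_point.
Proof. by []. Qed.

HB.instance Definition _ := isMeasurableFun.Build _ _ bool R signed_point
  measurable_signed_point.

(** The weight p sits at a. As the image of a Bernoulli law it inherits its probability structure,
    and its integrals reduce to integrals over [bool]. *)
Definition two_point p : probability R R :=
  distribution (bernoulli_prob p) signed_point.

Lemma two_pointE p A : 0 <= p <= 1 ->
  two_point p A = ((1 - p)%:E * \d_(- a)%R A + p%:E * \d_a A)%E.
Proof.
move=> p01; transitivity (bernoulli_prob p (signed_point @^-1` A)) => //.
by rewrite bernoulli_probE// addeC.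
Qed.

Lemma ge0_integral_two_point p f : 0 <= p <= 1 -> measurable_fun setT f ->
  (forall x, 0 <= f x) ->
  (\int[two_point p]_x (f x)%:E = ((1 - p) * f (- a) + p * f a)%:E)%E.
Proof.
move=> p01 mf f0; rewrite ge0_integral_distribution/=.
- rewrite integral_bernoulli_prob//=; last by move=> b; rewrite lee_fin.
  by rewrite addeC !EFinD !EFinM.
- exact/measurable_EFinP.
- by move=> x; rewrite lee_fin.
Qed.

Lemma integrable_two_point p f : 0 <= p <= 1 -> measurable_fun setT f ->
  (two_point p).-integrable setT (EFin \o f).
Proof.
move=> p01 mf; apply/integrableP; split; first exact/measurable_EFinP.
rewrite (ge0_integral_two_point _ (fun x => `|f x|))// ?ltry//.
exact: measurableT_comp.
Qed.

Lemma integral_two_point p f : 0 <= p <= 1 -> measurable_fun setT f ->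
  (\int[two_point p]_x (f x)%:E = ((1 - p) * f (- a) + p * f a)%:E)%E.
Proof.
move=> p01 mf.
(* Splitting into positive and negative parts reduces the claim to the nonnegative case. *)
have fE x : f x = Num.max (f x) 0 - Num.max (- f x) 0.
  by case: (leP (f x) 0); case: (leP (- f x) 0); lra.
have mfp : measurable_fun setT (fun x => Num.max (f x) 0).
  exact: measurable_maxr.
have mfn : measurable_fun setT (fun x => Num.max (- f x) 0).
  by apply: measurable_maxr => //; exact: measurableT_comp.
under eq_integral do rewrite fE EFinB.
rewrite integralB//; last 2 first.
- exact: (integrable_two_point _ (fun x => Num.max (f x) 0)).
- exact: (integrable_two_point _ (fun x => Num.max (- f x) 0)).
rewrite !ge0_integral_two_point//; last 2 first.
- by move=> x; rewrite le_max lexx orbT.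
- by move=> x; rewrite le_max lexx orbT.
rewrite -EFinB [in RHS](fE a) [in RHS](fE (- a)); congr EFin; ring.
Qed.

(** The reference measure P + Q is the sum of the two Dirac masses, so densities at the atoms are
    atom masses: p and q at a, swapped at - a. Each atom contributes sqrt (p q). *)
Lemma hellinger_two_point p q : a != - a -> 0 <= p <= 1 -> p + q = 1 ->
  hellinger (two_point p) (two_point q) = (2 * Num.sqrt (p * q))%:E.
Proof.
move=> aNa p01 pq.
have q01 : 0 <= q <= 1 by move: p01 => /andP[]; lra.
have Naa : - a != a by rewrite eq_sym.
have [/andP[p0 p1] /andP[q0 q1]] := (p01, q01).
set P := two_point p; set Q := two_point q.
pose nu := measure_add P Q : {finite_measure set R -> \bar R}.
(* Since p + q = 1, both atoms of P + Q have mass 1. *)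
have nuI D (f : R -> \bar R) : measurable D -> measurable_fun D f ->
    (forall x, D x -> 0 <= f x)%E ->
    (\int[nu]_(x in D) f x = \d_(- a)%R D * f (- a)%R + \d_a D * f a)%E.
  move=> mD mf f0.
  rewrite (eq_measure_integral (measure_add \d_(- a)%R \d_a)).
    by rewrite ge0_integral_measure_add// !integral_dirac.
  move=> A mA _; transitivity (two_point p A + two_point q A)%E.
    exact: measure_addE.
  transitivity (\d_(- a)%R A + \d_a A : \bar R)%E; last exact/esym/measure_addE.
  rewrite !two_pointE// addeACA -!ge0_muleDl ?lee_fin ?subr_ge0//.
  have -> : ((1 - p)%:E + (1 - q)%:E = 1 :> \bar R)%E.
    by rewrite -EFinD; congr EFin; lra.
  by rewrite -EFinD pq !mul1r.
have Pnu : P `<< nu by exact: null_dominates_measure_addl.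
have Qnu : Q `<< nu by exact: null_dominates_measure_addr.
(* Integrating the density over a singleton atom, of unit reference mass, returns its value
   there. *)
have densE r x : two_point r `<< nu -> x = a \/ x = - a ->
    Radon_Nikodym_SigmaFinite.f (two_point r) nu x = two_point r [set x].
  move=> rnu xa; rewrite (Radon_Nikodym_SigmaFinite.f_integral rnu)//.
  rewrite nuI//; last 2 first.
  - apply: measurable_funTS; apply: measurable_int.
    exact: Radon_Nikodym_SigmaFinite.f_integrable.
  - by move=> y _; exact: Radon_Nikodym_SigmaFinite.f_ge0.
  by rewrite !diracE; case: xa => ->;
    rewrite !in_set1 !eqxx ?(negbTE aNa) ?(negbTE Naa) mul0e mul1e
      ?add0e ?adde0.
have atomE r : 0 <= r <= 1 -> two_point r [set a] = r%:E /\
    two_point r [set - a] = (1 - r)%:E.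
  move=> r01; rewrite !two_pointE// !diracE.
  rewrite !in_set1 !eqxx (negbTE aNa) (negbTE Naa).
  by rewrite !mule0 !mule1 add0e adde0.
rewrite (@hellinger_change_of_variables _ _ R nu P Q Pnu Qnu) nuI//; last first.
  by apply: measurable_sqrt_fineM; apply: measurable_int;
    exact: Radon_Nikodym_SigmaFinite.f_integrable.
have [Pa PNa] := atomE _ p01; have [Qa QNa] := atomE _ q01.
have aE := or_introl erefl : a = a \/ a = - a.
have NaE := or_intror erefl : - a = a \/ - a = - a.
rewrite (densE _ _ Pnu aE) (densE _ _ Qnu aE) Pa Qa.
rewrite (densE _ _ Pnu NaE) (densE _ _ Qnu NaE) PNa QNa.
rewrite !diracT !mul1e/=.
have -> : 1 - p = q by lra.
have -> : 1 - q = p by lra.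
by rewrite -EFinD mulrC -mulr2n mulr_natl.
Qed.

(** The square is constantly a^2 on both atoms, so the variance is a^2 - mu^2. *)
Lemma moment_class_two_point p mu B : 0 <= p <= 1 -> (2 * p - 1) * a = mu ->
  a ^+ 2 - mu ^+ 2 <= B ->
  moment_class (fun x => x ^+ 2) B mu (two_point p).
Proof.
move=> p01 muE aB; split.
- exact: (@integrable_two_point p (fun x => x)).
- rewrite (@integral_two_point p (fun x => x))//; congr EFin.
  by rewrite -muE; ring.
- rewrite (@integral_two_point p (fun x => (x - mu) ^+ 2))//; last first.
    by apply: measurable_funX; exact: measurable_funB.
  rewrite lee_fin; apply: le_trans aB; rewrite -muE.
  by rewrite le_eqVlt; apply/orP; left; apply/eqP; ring.
Qed.

End two_point.

(** * The dual certificate for phi = x^2 *)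

Section dual.
Context {R : realType} (sigma Delta : R).
Hypotheses (sigma0 : 0 < sigma) (Delta0 : 0 < Delta).

Local Notation phi := (fun x : R => x ^+ 2).
Local Notation D := (sigma ^+ 2 + Delta ^+ 2).
Local Notation lam := (Delta / D, Delta ^+ 2 / (2 * sigma ^+ 2 * D)).
Local Notation r0 := (2^-1 * ln (1 + (Delta / sigma) ^+ 2)).
(** Completing the square in [g_u] at x + Delta places the vertex at - c, with minimum 1/2;
    positivity and monotonicity to the right of - c can then be read off from [G]. *)
Let c := D / Delta.
Let G x := 2^-1 + lam.2 * (x + c) ^+ 2.

Let DN0 : D != 0.
Proof. by rewrite gt_eqF// addr_gt0// exprn_gt0. Qed.
Let sigmaN0 : sigma != 0. Proof. by rewrite gt_eqF. Qed.
Let DeltaN0 : Delta != 0. Proof. by rewrite gt_eqF. Qed.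

Let lam2_ge0 : 0 <= lam.2.
Proof.
rewrite /= divr_ge0 ?sqr_ge0// mulr_ge0 ?addr_ge0 ?sqr_ge0//.
by rewrite mulr_ge0 ?sqr_ge0.
Qed.

Let g_uE x : g_u phi (sigma ^+ 2) lam (x + Delta) = G x.
Proof.
rewrite /g_u /G /c/=; field.
by rewrite DN0 sigmaN0 DeltaN0.
Qed.

Let g_lE x : g_l phi (sigma ^+ 2) lam (x - Delta) = G (- x).
Proof.
rewrite /g_l /G /c/=; field.
by rewrite DN0 sigmaN0 DeltaN0.
Qed.

Let G_gt0 x : 0 < G x.
Proof. by rewrite ltr_pwDl// mulr_ge0// sqr_ge0. Qed.

Let G_le x y : 0 <= x + c -> x <= y -> G x <= G y.
Proof.
move=> xc xy; rewrite lerD2l ler_wpM2l// ler_sqr ?nnegrE//; lra.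
Qed.

(** This is psi_l + r0 <= psi_u - r0. The square left over vanishes exactly when x^2 = D, that is,
    at the atoms of the optimal primal pair. *)
Let ln_G x : 2 * r0 <= ln (G x) + ln (G (- x)).
Proof.
rewrite mulrA divff// mul1r -lnM ?posrE// ler_ln ?posrE ?mulr_gt0//.
  have -> : G x * G (- x) =
      1 + (Delta / sigma) ^+ 2 + (lam.2 * (x ^+ 2 - D)) ^+ 2.
    rewrite /G /c/=; field.
    by rewrite DN0 sigmaN0 DeltaN0.
  by rewrite lerDl sqr_ge0.
by rewrite ltr_pwDl// sqr_ge0.
Qed.

Lemma multipliers_square : multipliers phi (sigma ^+ 2) lam.
Proof.
split=> // x; split.
  by rewrite -[x](subrK Delta) g_uE.
by rewrite -[x](addrK Delta) g_lE.
Qed.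

Lemma dual_certificate_square : exists psi : R -> R, nondecreasing_fun psi /\
  forall x, psi_l phi (sigma ^+ 2) Delta lam x + r0 <= psi x <=
            psi_u phi (sigma ^+ 2) Delta lam x - r0.
Proof.
exists (fun x => - ln (G (- Num.min x c)) + r0); split.
  move=> x y xy; rewrite lerD2r lerN2 ler_ln ?posrE//.
  (* Truncation at c keeps the argument of [G] at or above - c, where [G] is nondecreasing. *)
  have mxc : Num.min y c <= c by rewrite ge_min lexx orbT.
  apply: G_le; first by lra.
  by rewrite lerN2 le_min !ge_min xy lexx orbT.
move=> x; rewrite /psi_l /psi_u g_lE g_uE lerD2r lerN2 ler_ln ?posrE//.
have c0 : 0 < c by rewrite divr_gt0// addr_gt0// exprn_gt0.
have [xc|cx] := leP x c.
  by rewrite lexx/=; have := ln_G x; lra.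
apply/andP; split.
  by rewrite /G lerD2l ler_wpM2l// addNr expr0n sqr_ge0.
(* The upper bound holds at c by [ln_G] and only increases afterwards. *)
have := ln_G c.
have : ln (G c) <= ln (G x) by rewrite ler_ln ?posrE//; apply: G_le; lra.
lra.
Qed.

End dual.

(** * The primal certificate and the equality of the three rates *)

Theorem proposition4 (R : realType) (sigma : R) (hsigma : 0 < sigma)
    (Delta : R) (hDelta : 0 < Delta) :
  let phi : R -> R := fun x => x ^+ 2 in
  let B : R := sigma ^+ 2 in
  let r : \bar R := hellinger_rate phi B Delta in
  [/\ [/\ multiplier_rate phi B Delta = exp_rate phi B Delta,
          exp_rate phi B Delta = r &
          r = (2^-1 * ln (1 + (Delta / sigma) ^+ 2))%:E],
      (let lam : R * R :=
         (Delta / (sigma ^+ 2 + Delta ^+ 2),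
          Delta ^+ 2 / (2 * sigma ^+ 2 * (sigma ^+ 2 + Delta ^+ 2))) in
       multipliers phi B lam /\
       exists psi : R -> R, nondecreasing_fun psi /\
         forall x : R,
           ((psi_l phi B Delta lam x)%:E + r <= (psi x)%:E)%E /\
           ((psi x)%:E <= (psi_u phi B Delta lam x)%:E - r)%E) &
      (let s : R := (Delta / sigma) / Num.sqrt (1 + (Delta / sigma) ^+ 2) in
       let a : R := sigma * Num.sqrt (1 + (Delta / sigma) ^+ 2) in
       [/\ 0 < s < 1,
           a = Delta / s &
           exists Pm Pp : probability R R,
             [/\ forall A : set R, measurable A ->
                   Pm A = (((1 + s) / 2)%:E * \d_(- a)%R A
                           + ((1 - s) / 2)%:E * \d_a A)%E,
                 forall A : set R, measurable A ->
                   Pp A = (((1 - s) / 2)%:E * \d_(- a)%R A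
                           + ((1 + s) / 2)%:E * \d_a A)%E,
                 moment_class phi B (- Delta) Pm,
                 moment_class phi B Delta Pp &
                 hellinger Pm Pp = expeR (- r)]])].
Proof.
move=> phi B r; set E := 1 + (Delta / sigma) ^+ 2.
have E0 : 0 < E by rewrite ltr_pwDl// sqr_ge0.
set r0 := 2^-1 * ln E; set w := Num.sqrt E.
have w2 : w ^+ 2 = E by rewrite sqr_sqrtr// ltW.
have w0 : 0 < w by rewrite sqrtr_gt0.
have t0 : 0 < Delta / sigma by rewrite divr_gt0.
have sN0 : sigma != 0 by rewrite gt_eqF.
have wN0 : w != 0 by rewrite gt_eqF.
set s := (Delta / sigma) / w; set a := sigma * w.
have s0 : 0 < s by rewrite divr_gt0.
have s2 : s ^+ 2 = 1 - E^-1.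
  rewrite /s expr_div_n w2 (_ : (Delta / sigma) ^+ 2 = E - 1); last first.
    by rewrite /E addrC addKr.
  by rewrite mulrBl mul1r divff// gt_eqF.
have s1 : s < 1.
  rewrite -(@ltr_pXn2r _ 2)// ?nnegrE ?(ltW s0)// s2 expr1n.
  by rewrite ltrBlDr ltrDl invr_gt0.
have sa : s * a = Delta by rewrite /s /a; field; rewrite wN0 sN0.
(* The optimal pair meets the variance constraint with equality. *)
have a2 : a ^+ 2 - Delta ^+ 2 = sigma ^+ 2.
  by rewrite exprMn w2 /E; field.
have a0 : 0 < a by rewrite mulr_gt0.
have p01 : 0 <= (1 - s) / 2 <= 1 by apply/andP; split; lra.
have q01 : 0 <= (1 + s) / 2 <= 1 by apply/andP; split; lra.
set Pm := two_point a ((1 - s) / 2); set Pp := two_point a ((1 + s) / 2).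
have PmC : moment_class phi B (- Delta) Pm.
  apply: moment_class_two_point => //; first by rewrite -sa; field.
  by rewrite sqrrN a2.
have PpC : moment_class phi B Delta Pp.
  apply: moment_class_two_point => //; first by rewrite -sa; field.
  by rewrite a2.
have hellE : hellinger Pm Pp = (expR (- r0))%:E.
  rewrite hellinger_two_point//; last 2 first.
  - by rewrite gt_eqF//; lra.
  - by field.
  (* Here 1 - s^2 = 1 / E = e^(-2 r0), so the product of the weights is a perfect square. *)
  congr EFin; have -> : (1 - s) / 2 * ((1 + s) / 2) = (expR (- r0) / 2) ^+ 2.
    have -> : (1 - s) / 2 * ((1 + s) / 2) = (1 - s ^+ 2) / 2 ^+ 2 by field.
    rewrite s2 expr_div_n; congr (_ / _); rewrite expr2 -expRD.
    have -> : - r0 - r0 = - ln E by rewrite /r0; field.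
    by rewrite expRN lnK ?posrE// opprB addrC subrK.
  rewrite sqrtr_sqr ger0_norm ?divr_ge0 ?expR_ge0//.
  by rewrite mulrC divfK.
have mphi : measurable_fun setT phi by exact: measurable_funX.
have phi0 x : 0 <= phi x by exact: sqr_ge0.
have [psi [ndpsi hpsi]] := dual_certificate_square _ _ hsigma hDelta.
have mC := multipliers_square _ _ hsigma hDelta.
have le_r0_mult : (r0%:E <= multiplier_rate phi B Delta)%E.
  apply: ereal_sup_ubound; exists r0 => //; eexists; exists psi; split.
  - exact: mC.
  - exact: ndpsi.
  - exact: hpsi.
have mult_exp := @multiplier_rate_le_exp_rate _ _ B mphi phi0 Delta.
have exp_hell := @exp_rate_le_hellinger_rate _ _ B mphi phi0 Delta.
have hell_r0 : (hellinger_rate phi B Delta <= r0%:E)%E.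
  rewrite /hellinger_rate leeNl -EFinN.
  set S := ereal_sup _.
  (* Besides bounding S from below, this makes S nonnegative, as the monotonicity of [lne] used next
     requires. *)
  have hS : (hellinger Pm Pp <= S)%E.
    by apply: ereal_sup_ubound; exists Pm => //; exists Pp.
  rewrite -[leLHS]expeRK lee_lne; first by rewrite /= -hellE.
    by rewrite in_itv/= leey lee_fin expR_ge0.
  by rewrite in_itv/= leey (le_trans _ hS)// hellE lee_fin expR_ge0.
(* The cycle r0 <= r_M' <= r_M <= r <= r0 forces all the rates to coincide. *)
have rE : r = r0%:E.
  apply/le_anti; rewrite hell_r0/=.
  exact: le_trans (le_trans le_r0_mult mult_exp) exp_hell.
have expE : exp_rate phi B Delta = r0%:E.
  apply/le_anti; rewrite (le_trans exp_hell hell_r0)/=.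
  exact: le_trans le_r0_mult mult_exp.
have multE : multiplier_rate phi B Delta = r0%:E.
  by apply/le_anti; rewrite le_r0_mult -[in leRHS]expE mult_exp.
split.
- by split; rewrite ?multE ?expE.
- split; first exact: mC.
  exists psi; split=> // x; have /andP[hl hu] := hpsi x.
  by rewrite rE -EFinD -EFinB !lee_fin.
- split; first by rewrite s0 s1.
    by apply: (canRL (mulfK _)); rewrite ?gt_eqF// mulrC.
  exists Pm, Pp; split => //; last by rewrite rE hellE.
  + move=> A _; rewrite two_pointE//.
    by have -> : 1 - (1 - s) / 2 = (1 + s) / 2 by lra.
  + move=> A _; rewrite two_pointE//.
    by have -> : 1 - (1 + s) / 2 = (1 - s) / 2 by lra.
Qed.
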